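(* Let $X$ be an irreducible continuum. Then $NC_1(X)=NWC_1(X)$ if and only if $X$ is an arc.
   Context: All spaces are metric; a continuum is a compact connected space with more than one point. For a non-empty space $Y$: $2^Y$ is the set of non-empty compact subsets of $Y$; the subcontinua of $Y$ are the non-empty compact connected subsets of $Y$. An arc is a space homeomorphic to $[0,1]$. A continuum $X$ is irreducible if there exist $p,q\in X$ such that no proper subcontinuum of $X$ contains $\{p,q\}$. A non-empty space $Y$ is $1$-$Q2$ if there exists a one-point set $B\subset Y$ such that for each $x\in Y$ there exists a continuum $D\subset Y$ with $x\in D$ and $B\cap D\neq\emptyset$. For a continuum $X$: $NWC_1(X)=\{A\in 2^X: A=X$ or $X-A$ is $1$-$Q2\}$; $NC_1(X)=\{A\in 2^X: X-A$ has at most one component$\}$. *)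

(* Defs.v *)
From HB Require Import structures.
From mathcomp Require Import all_boot all_order all_algebra.
From mathcomp Require Import all_classical all_reals all_analysis.
Import numFieldNormedType.Exports.

Set Implicit Arguments.
Unset Strict Implicit.
Unset Printing Implicit Defensive.

Local Open Scope classical_set_scope.
Local Open Scope ring_scope.

(* Spaces are subsets of an ambient topological space with the induced
   topology; a whole space [X] is [setT : set X]. *)

Definition is_continuum (X : topologicalType) (Y : set X) : Prop :=
  [/\ compact Y, connected Y & exists x y, [/\ Y x, Y y & x <> y]].

(* Unlike continua, subcontinua may consist of a single point. *)
Definition subcontinuum (X : topologicalType) (Y C : set X) : Prop :=
  [/\ C `<=` Y, C !=set0, compact C & connected C].

Definition irreducible (X : topologicalType) : Prop :=
  exists p q : X, forall C : set X,
    subcontinuum setT C -> C `<` setT -> ~ [set p; q] `<=` C.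

Definition one_Q2 (X : topologicalType) (Y : set X) : Prop :=
  Y !=set0 /\
  exists B : set X,
    [/\ exists b, B = [set b],
        B `<=` Y &
        forall x, Y x -> exists D : set X,
          [/\ is_continuum D, D `<=` Y, D x & B `&` D !=set0]].

Definition hyperspace (X : topologicalType) (Y : set X) : set (set X) :=
  [set A | [/\ A `<=` Y, A !=set0 & compact A]].

Definition NWC1 (X : topologicalType) : set (set X) :=
  [set A | hyperspace setT A /\ (A = setT \/ one_Q2 (setT `\` A))].

Arguments NWC1 : clear implicits.

Definition components (X : topologicalType) (Y : set X) : set (set X) :=
  connected_component Y @` Y.

Definition NC1 (X : topologicalType) : set (set X) :=
  [set A | hyperspace setT A /\ is_subset1 (components (setT `\` A))].

Arguments NC1 : clear implicits.

Definition homeomorphic (X Y : topologicalType) : Prop :=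
  exists (f : X -> Y) (g : Y -> X),
    [/\ continuous f, continuous g, cancel f g & cancel g f].

Definition is_arc (R : realType) (X : topologicalType) : Prop :=
  homeomorphic X (set_type [set` `[0 : R, 1]]).

(* Main.v *)
Require Import Defs.
From HB Require Import structures.
From mathcomp Require Import all_boot all_order all_algebra.
From mathcomp Require Import all_classical all_reals all_analysis.
From mathcomp Require Import lra.
Import numFieldNormedType.Exports.
Local Open Scope classical_set_scope.

(** A set which is [one_Q2] is a union of continua through a common point, hence
    connected; so [NWC1 X] is always contained in [NC1 X], and the question is
    whether connected complements of non-empty compact sets are [one_Q2].

    If X is an arc, they are: two distinct points of a connected subset of
    [[0, 1]] are the ends of a segment contained in that subset
    ([arc_continuum_connected]).

    Conversely, let X be irreducible between p and q, and let x be a third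
    point. If the complement of x were connected, it would be [one_Q2], so a
    union of two continua would join p to q while missing x, against
    irreducibility. Hence every point other than p and q cuts X, and, again by
    irreducibility, the cut puts p and q on opposite sides
    ([irreducible_cut]). Comparing points by the sides on which they cut each
    other yields a strict total order whose open rays are open ([cut_order]).

    It remains to see that a metric continuum with such an order is an arc. For
    a continuous bounded g, the running supremum of g over the initial segments
    of the order is continuous ([continuous_running_sup]) and nondecreasing.
    Applying this to tent functions centred at the points of a dense sequence
    and summing with weights 2^-(n+1) gives a continuous function which is
    strictly increasing, because the tents detect every point outside a closed
    initial segment ([strictly_increasing_embedding]). It is thus a continuous
    injection of a continuum into the line, hence a homeomorphism onto a segment
    ([arc_of_injection]). *)

Import Order.TTheory GRing.Theory Num.Theory.
Local Open Scope ring_scope.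
Set Implicit Arguments.
Unset Strict Implicit.
Unset Printing Implicit Defensive.

(** * Total orders with open rays *)

(** Openness of the rays says that the topology is finer than the order
    topology, which is all that can be read off from cut points. *)
Record open_ray_order (X : topologicalType) (lt : X -> X -> Prop) : Prop := {
  ray_irr : forall x, ~ lt x x;
  ray_trans : forall y x z, lt x y -> lt y z -> lt x z;
  ray_total : forall x y, [\/ x = y, lt x y | lt y x];
  ray_open_lt : forall x, open [set y | lt y x];
  ray_open_gt : forall x, open [set y | lt x y] }.

(** If nothing lay strictly between x and y, the rays below y and above x would
    be complementary open sets. *)
Lemma connected_order_dense (X : topologicalType) (lt : X -> X -> Prop) :
  open_ray_order lt -> connected [set: X] ->
  forall x y, lt x y -> exists2 z, lt x z & lt z y.
Proof.
move=> ord conX x y xy; apply: contrapT => none.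
have E : [set z | lt z y] = ~` [set z | lt x z].
  apply/seteqP; split=> z /= zy.
    by move=> xz; apply: none; exists z.
  have [<-//|/zy//|zx] := ray_total ord x z.
  exact: (ray_trans ord zx xy).
suff : [set z | lt z y] = setT.
  by move/seteqP => [_ /(_ y I)]; exact: (ray_irr ord).
apply: conX; first by exists x.
  by exists [set z | lt z y]; [exact: ray_open_lt|rewrite setTI].
exists [set z | lt z y]; last by rewrite setTI.
by rewrite E; apply: open_closedC; exact: ray_open_gt.
Qed.

Definition running_sup (R : realType) (X : Type) (lt : X -> X -> Prop)
    (g : X -> R) (x : X) : R :=
  sup (g @` [set a | a = x \/ lt a x]).

Lemma running_sup_ub (R : realType) (X : Type) (lt : X -> X -> Prop)
    (g : X -> R) (M : R) (x a : X) :
  (forall z, g z <= M) -> a = x \/ lt a x -> g a <= running_sup lt g x.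
Proof.
move=> gM ax; apply: ub_le_sup; last by exists a.
by exists M => _ [z _ <-].
Qed.

Lemma running_sup_le (R : realType) (X : Type) (lt : X -> X -> Prop)
    (g : X -> R) (M : R) (x : X) :
  (forall a, a = x \/ lt a x -> g a <= M) -> running_sup lt g x <= M.
Proof.
move=> gM; apply: ge_sup; first by exists (g x), x => //; left.
by move=> _ [a /gM ? <-].
Qed.

Lemma running_sup_homo (R : realType) (X : topologicalType)
    (lt : X -> X -> Prop) (g : X -> R) (M : R) (x y : X) :
  open_ray_order lt -> (forall z, g z <= M) -> lt x y ->
  running_sup lt g x <= running_sup lt g y.
Proof.
move=> ord gM xy; apply: running_sup_le => a ax; apply: (running_sup_ub gM).
by right; case: ax => [->//|ax]; exact: (ray_trans ord ax xy).
Qed.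

(** Continuity from below: a value of g close to the supremum is attained at
    some a <= x; the bound persists on the ray above a, or by continuity of g
    when a is x itself. Continuity from above: the compact set C where g is too
    large lies strictly above x, and by density of the order each of its points is
    separated from x by an intermediate point; compactness makes the resulting
    neighbourhood of x uniform in C. *)
Lemma continuous_running_sup (R : realType) (X : topologicalType)
    (lt : X -> X -> Prop) (g : X -> R) (M : R) :
  open_ray_order lt -> compact [set: X] -> connected [set: X] ->
  continuous g -> (forall z, g z <= M) -> continuous (running_sup lt g).
Proof.
move=> ord cptX conX cg gM x; set m := running_sup lt g.
apply/cvgrPdist_lt => e e0.
have e20 : 0 < e / 2 by rewrite divr_gt0.
have lower : \forall y \near x, m x - e / 2 <= m y.
  have [a ax ga] : exists2 a, a = x \/ lt a x & m x - e / 2 < g a.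
    apply: contrapT => none.
    have : m x <= m x - e / 2.
      apply: running_sup_le => a ax; rewrite leNgt; apply/negP => ga.
      by apply: none; exists a.
    lra.
  case: ax => [ax|ax].
    rewrite {a}ax in ga.
    have := cg x; move/cvgr_gt => /(_ _ ga); apply: filterS => y gy.
    by rewrite (le_trans (ltW gy))//; apply: (running_sup_ub gM); left.
  have : nbhs x [set y | lt a y].
    by apply: open_nbhs_nbhs; split => //; exact: ray_open_gt.
  apply: filterS => y ay; rewrite (le_trans (ltW ga))//.
  by apply: (running_sup_ub gM); right.
have upper : \forall y \near x, m y <= m x + e / 2.
  pose C := [set c | m x + e / 2 <= g c].
  have cptC : compact C.
    apply: (subclosed_compact _ cptX) => //.
    exact: ((continuous_closedP g).1 cg _ (@closed_ge _ _)).
  have xC c : C c -> lt x c.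
    have xx : g x <= m x by apply: (running_sup_ub gM); left.
    move=> Cc; have [xc|//|cx] := ray_total ord x c; exfalso.
      by move: Cc; rewrite /C /= -xc; lra.
    have cm : g c <= m x by apply: (running_sup_ub gM); right.
    by move: Cc; rewrite /C/=; lra.
  have /compact_near_coveringP cover := cptC.
  have : \forall y \near x, C `<=` (fun c => lt y c).
    apply: (cover X (nbhs x) lt) => c /xC xc.
    have [z xz zc] := connected_order_dense ord conX xc.
    exists ([set c' | lt z c'], [set y | lt y z]).
      split; apply: open_nbhs_nbhs; split => //.
        exact: ray_open_gt.
      exact: ray_open_lt.
    by move=> [c' y] [/= zc' yz]; exact: (ray_trans ord yz zc').
  apply: filterS => y yC; apply: running_sup_le => a ay.
  rewrite leNgt; apply/negP => /ltW /yC ya.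
  case: ay => [ay|ay]; first by rewrite ay in ya; exact: (ray_irr ord ya).
  exact: (ray_irr ord (ray_trans ord ya ay)).
near=> y; rewrite ltr_norml.
have l : m x - e / 2 <= m y by near: y.
have u : m y <= m x + e / 2 by near: y.
by apply/andP; split; lra.
Unshelve. all: by end_near. Qed.

(** * A continuous strictly increasing function on an ordered continuum *)

Lemma compact_dense_sequence (R : realType) (X : pseudoMetricType R) (x0 : X) :
  compact [set: X] ->
  exists d : nat -> X, forall x (e : R), 0 < e -> exists n, ball x e (d n).
Proof.
(* A base point makes X an instance of the pointed structure over which second
   countability is stated. *)
pose pX : pseudoPMetricType R :=
  HB.pack (PseudoMetric.sort X) (PseudoMetric.class X)
    (isPointed.Build (PseudoMetric.sort X) x0).
move=> /(@compact_second_countable R pX) [B cntB [_ Bbase]].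
have [B0|[U]] := pfcard_geP cntB.
  have [V [BV _] _] := Bbase x0 setT (@filterT _ (nbhs x0) _).
  by rewrite B0 in BV.
exists (fun n => xget x0 (U n)) => x e e0.
have [V [BV Vx] Vsub] := Bbase x _ (nbhsx_ballx x e e0).
have [n _ UnV] : (U @` setT) V by exact: surj.
exists n; apply: Vsub; rewrite UnV.
exact: (@xgetI _ _ V x Vx).
Qed.

Definition dyadic_partial (R : realType) (X : Type) (u : nat -> X -> R)
    (n : nat) (x : X) : R :=
  \sum_(i < n) 2^-1 ^+ i.+1 * u i x.

(** For a sequence with values in [[0, 1]] the partial sums increase, so their
    supremum is the sum of the series; this form makes both the monotonicity
    and the geometric tail bound direct. *)
Definition dyadic_sum (R : realType) (X : Type) (u : nat -> X -> R)
    (x : X) : R :=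
  sup (range (dyadic_partial u ^~ x)).

Lemma dyadic_partial_mono (R : realType) (X : Type) (u : nat -> X -> R)
    (u01 : forall k z, 0 <= u k z <= 1) (x : X) :
  {homo dyadic_partial u ^~ x : m n / (m <= n)%N >-> m <= n}.
Proof.
apply: homo_leq; [exact: lexx|exact: le_trans|] => n.
rewrite /dyadic_partial big_ord_recr/= lerDl mulr_ge0//.
by have /andP[] := u01 n x.
Qed.

Lemma dyadic_upper_mono (R : realType) (X : Type) (u : nat -> X -> R)
    (u01 : forall k z, 0 <= u k z <= 1) (x : X) :
  {homo (fun n => - (dyadic_partial u n x + 2^-1 ^+ n)) :
    m n / (m <= n)%N >-> m <= n}.
Proof.
apply: homo_leq; [exact: lexx|exact: le_trans|] => n.
rewrite lerN2 /dyadic_partial big_ord_recr/= -addrA lerD2l.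
have /andP[_ u1] := u01 n x.
have p0 : 0 < 2^-1 ^+ n.+1 :> R by rewrite exprn_gt0.
have -> : 2^-1 ^+ n = 2 * 2^-1 ^+ n.+1 :> R.
  by rewrite exprS mulrA divff// mul1r.
by nra.
Qed.

Lemma dyadic_partial_tail (R : realType) (X : Type) (u : nat -> X -> R)
    (u01 : forall k z, 0 <= u k z <= 1) (x : X) (m n : nat) :
  dyadic_partial u m x <= dyadic_partial u n x + 2^-1 ^+ n.
Proof.
have h0 k : 0 <= 2^-1 ^+ k :> R by rewrite exprn_ge0.
have [mn|/ltnW nm] := leqP m n.
  by rewrite (le_trans (dyadic_partial_mono u01 x mn))// lerDl.
have /= := dyadic_upper_mono u01 x nm; rewrite lerN2; apply: le_trans.
by rewrite lerDl.
Qed.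

Lemma dyadic_partial_le (R : realType) (X : Type) (u : nat -> X -> R)
    (u01 : forall k z, 0 <= u k z <= 1) (n : nat) (x : X) :
  dyadic_partial u n x <= dyadic_sum u x.
Proof.
apply: ub_le_sup; last by exists n.
exists (dyadic_partial u 0 x + 2^-1 ^+ 0) => _ [k _ <-].
exact: dyadic_partial_tail.
Qed.

Lemma dyadic_sum_le (R : realType) (X : Type) (u : nat -> X -> R)
    (u01 : forall k z, 0 <= u k z <= 1) (n : nat) (x : X) :
  dyadic_sum u x <= dyadic_partial u n x + 2^-1 ^+ n.
Proof.
apply: ge_sup; first by exists (dyadic_partial u 0 x), 0%N.
by move=> _ [k _ <-]; exact: dyadic_partial_tail.
Qed.

(** A strict inequality in the k-th term is not lost in the supremum: every
    partial sum of more than k terms gains the fixed amount [d] below. *)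
Lemma dyadic_sum_lt (R : realType) (X : Type) (u : nat -> X -> R)
    (u01 : forall k z, 0 <= u k z <= 1) (k : nat) (x y : X) :
  (forall n, u n x <= u n y) -> u k x < u k y ->
  dyadic_sum u x < dyadic_sum u y.
Proof.
move=> uxy ukxy; pose d := 2^-1 ^+ k.+1 * (u k y - u k x).
have d0 : 0 < d by rewrite mulr_gt0 ?exprn_gt0 ?subr_gt0.
suff : dyadic_sum u x <= dyadic_sum u y - d by move=> h; lra.
apply: ge_sup; first by exists (dyadic_partial u 0 x), 0%N.
move=> _ [n _ <-].
apply: le_trans (_ : dyadic_partial u (maxn n k.+1) x <= _).
  exact: (dyadic_partial_mono u01 x (leq_maxl _ _)).
rewrite lerBrDr; apply: le_trans (dyadic_partial_le u01 (maxn n k.+1) y).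
have kl : (k < maxn n k.+1)%N by exact: leq_maxr.
rewrite -lerBrDl /dyadic_partial -sumrB (bigD1 (Ordinal kl))//= -mulrBr lerDl.
apply: sumr_ge0 => i _; rewrite -mulrBr mulr_ge0 ?exprn_ge0// subr_ge0.
exact: uxy.
Qed.

(** The tail bound makes the convergence of the partial sums uniform. *)
Lemma continuous_dyadic_sum (R : realType) (X : topologicalType)
    (u : nat -> X -> R) :
  (forall n x, 0 <= u n x <= 1) -> (forall n, continuous (u n)) ->
  continuous (dyadic_sum u).
Proof.
move=> u01 cu x.
have cS n : continuous (dyadic_partial u n).
  elim: n => [|n IHn].
    have -> : dyadic_partial u 0 = fun=> 0.
      by apply/funext => y; rewrite /dyadic_partial big_ord0.
    exact: cst_continuous.
  have -> : dyadic_partial u n.+1 =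
      fun y => dyadic_partial u n y + 2^-1 ^+ n.+1 * u n y.
    by apply/funext => y; rewrite /dyadic_partial big_ord_recr.
  move=> y; apply: cvgD; first exact: IHn.
  by apply: cvgM; [exact: cvg_cst|exact: cu].
apply/cvgrPdist_lt => e e0.
have [n ne] : exists n, 2^-1 ^+ n < e / 3 :> R.
  have e30 : 0 < e / 3 by rewrite divr_gt0.
  have h1 : `|2^-1| < 1 :> R by rewrite ger0_norm//; lra.
  have /cvgrPdist_lt /(_ _ e30) [n _ /(_ n (leqnn n))] :=
    @cvg_geometric R 1 _ h1.
  rewrite /= sub0r normrN mul1r ger0_norm ?exprn_ge0// => ?.
  by exists n.
have /cvgrPdist_lt/(_ (e / 3)) := cS n x.
rewrite divr_gt0// => /(_ isT); apply: filterS => y.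
rewrite !ltr_norml => /andP[h1 h2].
have := dyadic_partial_le u01 n x; have := dyadic_partial_le u01 n y.
have := dyadic_sum_le u01 n x; have := dyadic_sum_le u01 n y.
by move=> *; apply/andP; split; lra.
Qed.

Lemma mdist_lipschitz (R : realType) (X : metricType R) (c x y : X) :
  `|mdist c x - mdist c y| <= mdist x y.
Proof.
rewrite ler_norml.
have := metric_triangle c x y; have := metric_triangle c y x.
rewrite (metric_sym y x) => *; apply/andP; split; lra.
Qed.

Definition tent (R : realType) (X : metricType R) (c x : X) : R :=
  Num.max 0 (1 - mdist c x).

Lemma tent01 (R : realType) (X : metricType R) (c x : X) : 0 <= tent c x <= 1.
Proof.
by rewrite /tent le_max lexx ge_max ler01 gerBl mdist_ge0.
Qed.

Lemma continuous_tent (R : realType) (X : metricType R) (c : X) :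
  continuous (tent c).
Proof.
have cd : continuous (fun x => 1 - mdist c x : R^o).
  move=> x; apply/cvgrPdist_lt => e e0.
  have := nbhsx_ballx x e e0; apply: filterS => y.
  rewrite ballEmdist/= => xy.
  have -> : 1 - mdist c x - (1 - mdist c y) = mdist c y - mdist c x by lra.
  by apply: le_lt_trans xy; rewrite (metric_sym x y) mdist_lipschitz.
by move=> x; apply: (@continuous_max R X (fun=> 0)); [exact: cvg_cst|exact: cd].
Qed.

(** This is the Whitney map construction applied to the closed initial segments:
    when x < y, the ball of radius r around y misses the segment below x, so a
    tent centred within r/2 of y is larger at y than anywhere below x. *)
Lemma strictly_increasing_embedding (R : realType) (X : metricType R)
    (lt : X -> X -> Prop) :
  open_ray_order lt -> compact [set: X] -> connected [set: X] ->
  exists f : X -> R, continuous f /\ forall x y, lt x y -> f x < f y.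
Proof.
move=> ord cptX conX.
have [x0|noX] := pselect ([set: X] !=set0); last first.
  exists (fun=> 0); split; first exact: cst_continuous.
  by move=> x; absurd: noX; exists x.
case: x0 => x0 _.
have [d dd] := compact_dense_sequence x0 cptX.
pose u n := running_sup lt (tent (d n)).
have t1 n (z : X) : tent (d n) z <= 1 by case/andP: (tent01 (d n) z).
have u01 n x : 0 <= u n x <= 1.
  apply/andP; split; last exact: (running_sup_le (fun a _ => t1 n a)).
  have /andP[t0 _] := tent01 (d n) x; apply: (le_trans t0).
  by apply: (running_sup_ub (t1 n)); left.
have cu n : continuous (u n).
  exact: (continuous_running_sup ord cptX conX (@continuous_tent _ _ _) (t1 n)).
exists (dyadic_sum u); split; first exact: continuous_dyadic_sum.
move=> x y xy.
have umono n : u n x <= u n y by exact: (running_sup_homo ord (t1 n) xy).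
have : nbhs y [set z | lt x z].
  by apply: open_nbhs_nbhs; split => //; exact: ray_open_gt.
move=> /nbhs_ballP[e /= e0 ye].
pose r := Num.min e 1.
have r0 : 0 < r by rewrite lt_min e0 ltr01.
have r20 : 0 < r / 2 by rewrite divr_gt0.
have [n] := dd y _ r20; rewrite ballEmdist/= => dy.
apply: (@dyadic_sum_lt _ _ _ u01 n) => //.
apply: (@le_lt_trans _ _ (1 - r / 2)).
  apply: running_sup_le => a ax.
  have ya : r <= mdist y a.
    rewrite leNgt; apply/negP => ya.
    have /ye : ball y e a.
      by rewrite ballEmdist/= (lt_le_trans ya)// ge_min lexx.
    move=> /= xa; case: ax => [ax|ax].
      by rewrite ax in xa; exact: (ray_irr ord xa).
    exact: (ray_irr ord (ray_trans ord xa ax)).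
  have tr := metric_triangle y (d n) a.
  have r1 : r <= 1 by rewrite ge_min lexx orbT.
  by rewrite /tent ge_max; apply/andP; split; lra.
apply: (@lt_le_trans _ _ (tent (d n) y)).
  by rewrite /tent lt_max metric_sym; apply/orP; right; lra.
by apply: (running_sup_ub (t1 n)); left.
Qed.

(** * Cut points and the order they induce *)

Lemma closed_add_point (X : topologicalType) (x : X) (U V : set X) :
  open V -> U `|` V = ~` [set x] -> U `&` V = set0 -> closed (x |` U).
Proof.
move=> oV UV dUV; suff -> : x |` U = ~` V by exact: open_closedC.
apply/seteqP; split=> z /=.
  move=> [->|Uz] Vz; last by suff : (U `&` V) z by rewrite dUV.
  by suff : (U `|` V) x; [rewrite UV => /(_ erefl)|right].
move=> nVz; have [->|zx] := pselect (z = x); first by left.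
right; have : (U `|` V) z by rewrite UV.
by case.
Qed.

(** Collapsing V to x is a continuous retraction of X onto the union of U and x,
    so this union is the image of a connected space. *)
Lemma connected_add_point (X : topologicalType) (x : X) (U V : set X) :
  connected [set: X] -> open U -> open V ->
  U `|` V = ~` [set x] -> U `&` V = set0 -> connected (x |` U).
Proof.
move=> conX oU oV UV dUV.
have clU : closed (x |` U) by exact: closed_add_point oV UV dUV.
have clV : closed (x |` V).
  by apply: closed_add_point oU _ _; rewrite 1?setUC// setIC.
pose r (z : X) : X := if pselect (U z) then z else x.
have rU z : U z -> r z = z by rewrite /r; case: pselect.
have rV z : ~ U z -> r z = x by rewrite /r; case: pselect.
have UT : (x |` U) `|` (x |` V) = setT.
  apply/seteqP; split=> // z _; have [->|zx] := pselect (z = x).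
    by left; left.
  have : (U `|` V) z by rewrite UV.
  by move=> [Uz|Vz]; [left|right]; right.
have nUx : ~ U x.
  by move=> Ux; suff : (U `|` V) x; [rewrite UV => /(_ erefl)|left].
have cr : {within setT, continuous r}.
  rewrite -UT; apply: withinU_continuous => //.
    apply: (@subspace_eq_continuous _ (x |` U) X (id : X -> X) r).
      move=> z /[!inE] -[->|/rU//]; by rewrite rV.
    by apply: continuous_subspaceT => z; exact: cvg_id.
  apply: (@subspace_eq_continuous _ (x |` V) X (fun=> x) r).
    move=> z /[!inE] -[->|Vz]; first by rewrite rV.
    by rewrite rV// => Uz; suff : (U `&` V) z by rewrite dUV.
  by apply: continuous_subspaceT => z; exact: cvg_cst.
suff <- : r @` setT = x |` U by exact: connected_continuous_connected.
apply/seteqP; split=> z /=.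
  move=> [y _ <-]; have [Uy|nUy] := pselect (U y).
    by rewrite rU//; right.
  by rewrite rV//; left.
by move=> [->|Uz]; [exists x; rewrite ?rV|exists z; rewrite ?rU].
Qed.

Lemma open_disjoint_separated (X : topologicalType) (U V : set X) :
  open U -> open V -> U `&` V = set0 -> separated U V.
Proof.
move=> oU oV dUV; split; apply/seteqP; split=> // z [].
  move=> clU Vz; have [w] := clU V (open_nbhs_nbhs (conj oV Vz)).
  by rewrite dUV.
move=> Uz clV; have [w] := clV U (open_nbhs_nbhs (conj oU Uz)).
by rewrite setIC dUV.
Qed.

(** A cut at x with p on the left and q on the right. The ends p and q are
    allowed to be x itself, so that trivial cuts exist at p and at q and all
    points can be treated alike. *)
Record point_cut (X : topologicalType) (p q x : X) (U V : set X) : Prop := {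
  cut_open_l : open U;
  cut_open_r : open V;
  cut_cover : U `|` V = ~` [set x];
  cut_disjoint : U `&` V = set0;
  cut_connected_l : connected (x |` U);
  cut_connected_r : connected (x |` V);
  cut_mem_l : (x |` U) p;
  cut_mem_r : (x |` V) q }.

Lemma point_cutC (X : topologicalType) (p q x : X) (U V : set X) :
  point_cut p q x U V -> point_cut q p x V U.
Proof. by case=> *; split=> //; rewrite 1?setUC// 1?setIC. Qed.

(** The closed left side at x is connected, contains p and misses y, so it stays
    on the left side of y. *)
Lemma point_cut_subset (X : topologicalType) (p q x y : X)
    (Ux Vx Uy Vy : set X) :
  point_cut p q x Ux Vx -> point_cut p q y Uy Vy -> Vx y -> x |` Ux `<=` Uy.
Proof.
move=> [_ _ UVx dx conUx _ px _] [oUy oVy UVy dy _ _ py _] Vxy.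
have sub : x |` Ux `<=` Uy `|` Vy.
  rewrite UVy => z Uz /= zy; rewrite {z}zy in Uz.
  case: Uz => [yx|Uxy].
    by suff : (Ux `|` Vx) x; [rewrite UVx => /(_ erefl)|right; rewrite -yx].
  by suff : (Ux `&` Vx) y by rewrite dx.
have [//|UxVy] :=
  connected_subset (open_disjoint_separated oUy oVy dy) sub conUx.
have Vyp := UxVy _ px; case: py => [py|Uyp].
  by suff : (Uy `|` Vy) y; [rewrite UVy => /(_ erefl)|right; rewrite -py].
by suff : (Uy `&` Vy) p by rewrite dy.
Qed.

(** The order is: x < y when x is on the left of y. Comparing cuts shows that
    this holds exactly when y is on the right of x, so both kinds of rays are
    open. *)
Lemma cut_order (X : topologicalType) (p q : X) :
  (forall x, exists U V, point_cut p q x U V) ->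
  exists lt : X -> X -> Prop, open_ray_order lt.
Proof.
move=> /choice [U] /choice [V] cut.
have below x y : V x y -> x |` U x `<=` U y := point_cut_subset (cut x) (cut y).
have above x y : U x y -> x |` V x `<=` V y.
  exact: (point_cut_subset (point_cutC (cut x)) (point_cutC (cut y))).
have VU x y : V x y <-> U y x.
  split; first by move/below; apply; left.
  by move/above; apply; left.
have irr x : ~ U x x.
  move=> Ux; suff : (U x `|` V x) x; last by left.
  by rewrite (cut_cover (cut x)) => /(_ erefl).
exists (fun x y => U y x); split=> [//|y x z Uyx Uzy|x y|x|x].
- by apply: (below y z) => //; [exact/VU|right].
- have [->|xy] := pselect (x = y); first exact: Or31.
  have : (U y `|` V y) x by rewrite (cut_cover (cut y)).
  by move=> [Uyx|/VU Uxy]; [exact: Or32|exact: Or33].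
- exact: cut_open_l (cut x).
- suff -> : [set y | U y x] = V x by exact: cut_open_r (cut x).
  by apply/seteqP; split=> y /VU.
Qed.

(** Were p and q on the same side of x, that side together with x would be a
    subcontinuum containing both and missing the other side. *)
Lemma irreducible_cut (X : topologicalType) (p q x : X) :
  hausdorff_space X -> compact [set: X] -> connected [set: X] ->
  (forall C, subcontinuum setT C -> C `<` setT -> ~ [set p; q] `<=` C) ->
  (x <> p -> x <> q -> ~ connected (~` [set x])) ->
  exists U V, point_cut p q x U V.
Proof.
move=> hX cptX conX irr dis.
have clx : closed [set x].
  exact: accessible_closed_set1 (hausdorff_accessible hX) x.
have oCx : open (~` [set x]) by exact: closed_openC.
have xCx : x |` ~` [set x] = setT by rewrite setUv.
have [<-|xp] := pselect (x = p).
  exists set0, (~` [set x]); split; rewrite ?set0U ?set0I ?setU0 ?xCx//.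
  - exact: open0.
  - exact: connected1.
have [<-|xq] := pselect (x = q).
  exists (~` [set x]), set0; split; rewrite ?setU0 ?setI0 ?xCx//.
  - exact: open0.
  - exact: connected1.
have /connectedPn[E [E0 EU [sE1 sE2]]] := dis xp xq.
have UE b : E b `|` E (~~ b) = ~` [set x] by case: b; rewrite EU// setUC.
have dE b : E b `&` E (~~ b) = set0.
  apply/seteqP; split=> // z [Ebz Enz].
  suff : (closure (E false) `&` E true) z by rewrite sE1.
  by case: b Ebz Enz => Ebz Enz; split=> //; exact: subset_closure.
have sE b : closure (E b) `&` E (~~ b) = set0 by case: b => //=; rewrite setIC.
have oE b : open (E b).
  suff -> : E b = ~` closure (E (~~ b)) `&` ~` [set x].
    by apply: openI => //; apply: closed_openC; exact: closed_closure.
  rewrite -(UE b); apply/seteqP; split=> z /=.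
    move=> Ez; split; last by left.
    move=> clz; suff : (closure (E (~~ b)) `&` E (~~ ~~ b)) z by rewrite sE.
    by rewrite negbK.
  by move=> [ncl [//|/subset_closure]].
have cE b : connected (x |` E b).
  exact: connected_add_point conX (oE b) (oE (~~ b)) (UE b) (dE b).
have proper b : E b p -> E (~~ b) q.
  move=> Ebp; have : (E b `|` E (~~ b)) q by rewrite UE => /esym.
  move=> [Ebq|//]; exfalso; apply: (irr (x |` E b)).
  - split=> //; first by exists x; left.
    apply: (subclosed_compact _ cptX) => //.
    exact: closed_add_point (oE (~~ b)) (UE b) (dE b).
  - split=> // sub; have [z Ez] := E0 (~~ b).
    have [zx|Ebz] := sub z I.
      by suff : (E b `|` E (~~ b)) x;
        [rewrite UE => /(_ erefl)|right; rewrite -zx].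
    by suff : (E b `&` E (~~ b)) z by rewrite dE.
  - by move=> z [->|->]; right.
have [b Ebp] : exists b, E b p.
  have : (E false `|` E true) p by rewrite -EU => /esym.
  by move=> [Ep|Ep]; [exists false|exists true].
exists (E b), (E (~~ b)); split=> //; first by right.
by right; exact: proper.
Qed.

(** * Recognizing arcs, and continua inside arcs *)

Lemma arc_of_injection (R : realType) (X : topologicalType) (f : X -> R) :
  is_continuum [set: X] -> continuous f -> injective f -> is_arc R X.
Proof.
move=> [cptX conX [x0 [y0 [_ _ xy0]]]] cf injf.
have X0 : [set: X] !=set0 by exists x0.
have cfT : {within setT, continuous f} by exact: continuous_subspaceT.
have [p _ fp] := compact_EVT_min X0 cptX cfT.
have [q _ fq] := compact_EVT_max X0 cptX cfT.
have {}fp x : f p <= f x by apply: fp; rewrite inE.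
have {}fq x : f x <= f q by apply: fq; rewrite inE.
have pq : 0 < f q - f p.
  rewrite subr_gt0 lt_neqAle fp andbT; apply/eqP => fpq; apply: xy0.
  by apply/injf/le_anti/andP; split; apply: le_trans (fq _) _; rewrite -fpq.
pose h x := (f x - f p) / (f q - f p).
have h01 x : h x \in `[0, 1].
  rewrite in_itv/= divr_ge0 ?subr_ge0//=.
  by rewrite ler_pdivrMr// mul1r lerD2r.
have injh : injective h.
  move=> x y /(mulIf _) e; apply: injf; apply/eqP.
  by rewrite -(inj_eq (addIr (- f p))); apply/eqP/e; rewrite invr_eq0 gt_eqF.
have ch : continuous h.
  move=> x; apply: cvgM; last exact: cvg_cst.
  by apply: cvgB; [exact: cf|exact: cvg_cst].
have surjh t : t \in `[0, 1] -> exists x, h x = t.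
  rewrite in_itv/= => t01.
  have /connected_intervalP itv : connected (h @` setT).
    by apply: connected_continuous_connected => //; exact: continuous_subspaceT.
  have [||x _ <-] := itv 0 1 _ _ t t01; last by exists x.
    by exists p => //; rewrite /h subrr mul0r.
  by exists q => //; rewrite /h divff// gt_eqF.
pose S := set_type [set` `[0 : R, 1]].
have hS x : h x \in [set` `[0 : R, 1]] by rewrite inE; exact: h01.
pose F x : S := exist _ (h x) (hS x).
have valS (t : S) : exists x, h x = val t.
  by apply: surjh; have := valP t; rewrite inE.
have [G hG] := choice valS.
have FK : cancel F G by move=> x; apply: injh; rewrite hG.
have GK : cancel G F by move=> t; apply: val_inj; rewrite /= hG.
exists F, G; split=> //.
  exact: (@continuous_comp_initial _ _ _ (@set_val _ _) F).
apply/continuous_closedP => K clK.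
(* G is continuous because F is a closed map: images of closed subsets of the
   compact space X are compact in the line. *)
have -> : G @^-1` K = set_val @^-1` (h @` K).
  apply/seteqP; split=> t /=.
    by move=> Kt; exists (G t).
  move=> [x Kx hx]; suff -> : t = F x by rewrite FK.
  by apply: val_inj; rewrite /= hx.
have /continuous_closedP := @initial_continuous S R (@set_val _ _).
apply; apply: compact_closed; first exact: Rhausdorff.
apply: continuous_compact; first exact: continuous_subspaceT.
exact: subclosed_compact clK cptX _.
Qed.

(** Composing with the clamping of the line onto [[0, 1]] allows working with
    functions on the whole line instead of on a subtype. *)
Lemma arc_parametrization (R : realType) (X : topologicalType) :
  is_arc R X -> exists (h : X -> R) (g : R -> X),
    [/\ continuous h, continuous g & cancel h g].
Proof.
move=> [F [G [cF cG FK _]]].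
pose S := set_type [set` `[0 : R, 1]].
pose clamp (t : R) := Num.max 0 (Num.min t 1).
have clampS t : clamp t \in [set` `[0 : R, 1]].
  by rewrite inE/= in_itv/= /clamp le_max lexx/= ge_max ler01 ge_min lexx orbT.
pose c t : S := exist _ (clamp t) (clampS t).
have cc : continuous c.
  apply: (@continuous_comp_initial _ _ _ (@set_val _ _) c).
  move=> t; apply: (@continuous_max R R (fun=> 0) (fun t => Num.min t 1)).
    exact: cvg_cst.
  by apply: (@continuous_min R R id (fun=> 1)); [exact: cvg_id|exact: cvg_cst].
exists (fun x => val (F x)), (G \o c); split.
- move=> x; apply: continuous_comp; first exact: cF.
  exact: (@initial_continuous S R (@set_val _ _)).
- by move=> t; apply: continuous_comp; [exact: cc|exact: cG].
- move=> x /=; rewrite -[RHS]FK; congr G; apply: val_inj => /=.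
  have := valP (F x); rewrite inE/= in_itv/= /clamp => /andP[t0 t1].
  by rewrite (min_idPl t1) (max_idPr t0).
Qed.

Lemma arc_continuum_connected (R : realType) (X : topologicalType) (W : set X)
    (x y : X) :
  is_arc R X -> connected W -> W x -> W y -> x <> y ->
  exists D, [/\ is_continuum D, D `<=` W, D x & D y].
Proof.
move=> /arc_parametrization[h [g [ch cg hK]]] conW.
wlog hxy : x y / h x <= h y.
  move=> wl Wx Wy xy; have [|/ltW] := leP (h x) (h y).
    by move=> hxy; exact: wl.
  move=> hyx; have [|D [? ? ? ?]] := wl _ _ hyx Wy Wx; first exact/nesym.
  by exists D.
move=> Wx Wy xy.
have Dx : (g @` `[h x, h y]) x by exists (h x); rewrite ?hK//= in_itv/= lexx.
have Dy : (g @` `[h x, h y]) y.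
  by exists (h y); rewrite ?hK//= in_itv/= lexx hxy.
have cgT : {within `[h x, h y], continuous g} by exact: continuous_subspaceT.
exists (g @` `[h x, h y]); split=> //.
  split.
  - by apply: continuous_compact => //; exact: segment_compact.
  - by apply: connected_continuous_connected => //; exact: segment_connected.
  - by exists x, y.
have /connected_intervalP itv : connected (h @` W).
  by apply: connected_continuous_connected => //; exact: continuous_subspaceT.
move=> z [t /=]; rewrite in_itv/= => txy <-.
have [||w Ww hw] := itv (h x) (h y) _ _ t txy; [by exists x|by exists y|].
by rewrite -hw hK.
Qed.

(** * Connectedness of complements in terms of components *)

Lemma connected_components_subset1 (X : topologicalType) (W : set X) (b : X) :
  W b -> is_subset1 (components W) -> connected W.
Proof.
move=> Wb W1; suff -> : W = connected_component W b.
  exact: component_connected.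
apply/seteqP; split; last exact: connected_component_sub.
move=> x Wx; rewrite (_ : connected_component W b = connected_component W x).
  exact: connected_component_refl.
by apply: W1; [exists b|exists x].
Qed.

Lemma components_subset1_connected (X : topologicalType) (W : set X) :
  connected W -> is_subset1 (components W).
Proof.
move=> conW _ _ [x Wx <-] [y Wy <-].
by rewrite !connected_component_id.
Qed.

Lemma components_subset1_one_Q2 (X : topologicalType) (W : set X) :
  one_Q2 W -> is_subset1 (components W).
Proof.
move=> [_ [_ [[b ->] _ bW]]].
have cb x : W x -> connected_component W x = connected_component W b.
  move=> /bW [D [[_ conD _] DW Dx [_ [-> Db]]]].
  by apply: same_connected_component; exists D.
by move=> A B [x Wx <-] [y Wy <-]; rewrite !cb.
Qed.

Lemma NWC1_subset_NC1 (X : topologicalType) : NWC1 X `<=` NC1 X.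
Proof.
move=> A [hA [AT|/components_subset1_one_Q2]]; split=> //.
by rewrite AT setDv => B C [].
Qed.

(** * The characterization *)

Theorem corollary5p18 (R : realType) (X : metricType R)
    (X_continuum : is_continuum [set: X]) (X_irreducible : irreducible X) :
  NC1 X = NWC1 X <-> is_arc R X.
Proof.
have [cptX conX [x1 [y1 [_ _ xy1]]]] := X_continuum.
have hX : hausdorff_space X := @metric_hausdorff R X.
split=> [NC1E|arcX].
  have [p [q irr]] := X_irreducible.
  have cuts x : exists U V, point_cut p q x U V.
    apply: irreducible_cut => // xp xq conCx.
    have : NWC1 X [set x].
      rewrite -NC1E; split.
        by split; [|exists x|exact: compact_set1].
      by rewrite setTD; exact: components_subset1_connected.
    case=> _ [xT|[_ [_ [[b ->] _]]]].
      have px : [set x] p by rewrite xT.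
      exact: xp (esym px).
    rewrite setTD => bW.
    have [D [[cD conD _] DW Dp [_ [-> Db]]]] := bW p (nesym xp).
    have [E [[cE conE _] EW Eq [_ [-> Eb]]]] := bW q (nesym xq).
    apply: (irr (D `|` E)).
    - split=> //; first by exists p; left.
        exact: compactU.
      by apply: connectedU => //; exists b.
    - by split=> // /(_ x I) [/DW|/EW]; exact.
    - by move=> z [->|->]; [left|right].
  have [lt ord] := cut_order cuts.
  have [f [cf flt]] := strictly_increasing_embedding ord cptX conX.
  apply: (arc_of_injection X_continuum cf) => x y fxy.
  by have [//|/flt|/flt] := ray_total ord x y; rewrite fxy ltxx.
apply/seteqP; split; last exact: NWC1_subset_NC1.
move=> A [hA A1]; split=> //.
have [AT|AT] := pselect (A = setT); [by left|right].
move: A1; rewrite setTD => A1.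
have clA : closed A by case: hA => _ _ cA; exact: compact_closed.
have [b nAb] : exists b, (~` A) b.
  apply: contrapT => none; apply: AT; apply/seteqP; split=> // z _.
  by apply: contrapT => nAz; apply: none; exists z.
have conW := connected_components_subset1 nAb A1.
(* The continuum through b itself has to be non-degenerate. The complement of
   A is open, so it is not a singleton, as X is connected: it contains some c
   other than b, and a segment from b to c serves. *)
have [c nAc bc] : exists2 c, (~` A) c & b <> c.
  apply: contrapT => none.
  have Wb : ~` A = [set b].
    apply/seteqP; split=> [z nAz|_ ->//]; apply: contrapT => zb.
    by apply: none; exists z => // /esym.
  suff bT : [set b] = setT.
    have xb : [set b] x1 by rewrite bT.
    have yb : [set b] y1 by rewrite bT.
    by apply: xy1; rewrite xb yb.
  apply: conX; first by exists b.
    by exists (~` A); [exact: closed_openC|rewrite setTI].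
  exists [set b]; last by rewrite setTI.
  exact: accessible_closed_set1 (hausdorff_accessible hX) b.
split; first by exists b.
exists [set b]; split; [by exists b|by move=> _ ->|move=> x nAx].
have [xb|xb] := pselect (x = b).
  have [D [cD DW Db _]] := arc_continuum_connected arcX conW nAb nAc bc.
  by exists D; split=> //; [rewrite xb|exists b].
have [D [cD DW Dx Db]] := arc_continuum_connected arcX conW nAx nAb xb.
by exists D; split=> //; exists b.
Qed.
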